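(* Let $d\ge46$. Let $h_1<\dots<h_k$ and $h'_1<\dots<h'_{k'}$ be finite strictly increasing sequences of positive integers such that $h_1\ge7$, $h'_1\ge7$, $h_k=d+k+1$, $h'_{k'}=d+k'+1$, and $h_{i+1}-h_i\ge4$, $h'_{i+1}-h'_i\ge4$ for all relevant $i$. Then the lattices $L_d(h_1,\dots,h_k)$ and $L_d(h'_1,\dots,h'_{k'})$ are isometric if and only if $k=k'$ and $h_i=h'_i$ for all $i$.
   Context: For a strictly increasing (finite or infinite, possibly empty) sequence of positive integers $h_1<h_2<\dots$ (called holes) and an integer $d\ge1$, let $s_1<s_2<\dots<s_{d+2}$ be the $d+2$ smallest elements of $\{1,2,3,\dots\}\setminus\{h_1,h_2,\dots\}$, and define $L_d(h_1,h_2,\dots)=\{x\in\mathbb Z^{d+2}:\ \sum_{i=1}^{d+2}x_i=0,\ \sum_{i=1}^{d+2}s_ix_i=0\}$ with the standard inner product of $\mathbb R^{d+2}$; it is an even integral lattice of rank $d$. Isomorphism of lattices means isometry. *)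

(* Defs.v *)
From HB Require Import structures.
From mathcomp Require Import all_boot all_order all_algebra.
Unset Printing Implicit Defensive.
Import Order.TTheory GRing.Theory Num.Theory.

(* For a finite list of holes h, the d+2 smallest positive integers not in h.
   Among 1 .. d+2+size h there are at least d+2 non-holes, so taking the first
   d+2 non-holes of that range gives exactly the d+2 smallest non-holes. *)
Definition nonholes (d : nat) (h : seq nat) : seq nat :=
  take (d + 2) [seq x <- iota 1 (d + 2 + size h) | x \notin h].

(* s_i (0-indexed: s i = s_{i+1} of the paper) *)
Definition sval (d : nat) (h : seq nat) (i : nat) : nat := nth 0 (nonholes d h) i.

Local Open Scope ring_scope.

Definition dotZ {n : nat} (x y : 'rV[int]_n) : int := \sum_(i < n) x 0 i * y 0 i.

Definition inL (d : nat) (h : seq nat) (x : 'rV[int]_(d + 2)) : bool :=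
  (\sum_(i < d + 2) x 0 i == 0) &&
  (\sum_(i < d + 2) (sval d h i)%:Z * x 0 i == 0).

Definition Lisometric (d : nat) (h h' : seq nat) : Prop :=
  exists f : 'rV[int]_(d + 2) -> 'rV[int]_(d + 2),
    [/\ (forall x, inL d h x -> inL d h' (f x)),
        (forall x y, inL d h x -> inL d h y -> f (x + y) = f x + f y),
        (forall x y, inL d h x -> inL d h y -> f x = f y -> x = y),
        (forall y, inL d h' y -> exists2 x, inL d h x & f x = y)
      & (forall x y, inL d h x -> inL d h y -> dotZ (f x) (f y) = dotZ x y)].

Definition admissible_holes (d : nat) (h : seq nat) : Prop :=
  [/\ (0 < size h)%N,
      sorted ltn h,
      (7 <= head 0%N h)%N,
      last 0%N h = (d + size h + 1)%N
    & forall i : nat, (i.+1 < size h)%N -> (nth 0%N h i + 4 <= nth 0%N h i.+1)%N].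

(* Main.v *)
From Stdlib Require Import ZArith.
Require Import Defs.
From mathcomp Require Import all_boot all_order all_algebra.
From mathcomp Require Import zify ssrZ ring.

(** An isometry f of L = L_d(h) onto L' = L_d(h') turns every coordinate of L'
    into an additive functional phi on L with phi(x)^2 < (x, x) for x <> 0.
    Such a phi must be zero or, up to sign, a coordinate of L.  Indeed,
    evaluated on the least squares residual, the hypothesis says that the integer
    sequence y representing phi has squared distance less than 1 from the affine
    functions of the s_i.  Cut 48 of the s_i into four windows of 12 consecutive
    ones: some window contributes less than 1/4, so phi kills all vectors of
    norm 4 supported there and y is affine on it.  Subtract this affine function.
    Walking away from the window, two exceptional values would already cost at
    least 1: for exceptions close to each other this is a finite verification
    over all gap patterns of the s_i, and for distant ones the costs add up.

    Hence f permutes the coordinates up to signs.  The linear relations between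
    the coordinates of L are spanned by (1)_i and (s_i)_i, so the signs are all
    equal and s' is, up to the permutation, an affine function of s.  The slope
    is 1 or -1, and -1 is impossible because 2 is not a hole of h' while
    s_{d+2} - 1 is a hole of h. *)

Set Implicit Arguments.
Unset Strict Implicit.
Unset Printing Implicit Defensive.
Import Order.TTheory GRing.Theory Num.Theory.
Delimit Scope Z_scope with BZ.
Local Open Scope ring_scope.

(** * Certified lower bounds for least squares residuals *)

(* For n points (p_i, v_i) with moments A = sum p, B = sum p^2, Y = sum v,
   C = sum p v, E = sum v^2, the sum of squared residuals of the least squares
   line is (D (n E - Y^2) - (n C - A Y)^2) / (n D); the test says that it is at
   least 1 / t. *)
Definition misfit_ge (t n A B Y C E : Z) : bool :=
  let D := (n * B - A * A)%BZ in
  [&& (0 <? n)%BZ, (0 <? D)%BZ &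
      (n * D <=? t * (D * (n * E - Y * Y) - (n * C - A * Y) * (n * C - A * Y)))%BZ].

(* Runs [misfit_ge] on the word [w] of values ([None] is unconstrained) placed
   along every admissible pattern of gaps 1 and 2: after a gap 2 the next two
   gaps are 1, and [cool] counts how many of these are still due. *)
Fixpoint word_ge (t : Z) (w : seq (option Z)) (cool : nat)
    (p n A B Y C E : Z) : bool :=
  if w is x :: w' then
    let next k := if x is Some v then
        k (n + 1)%BZ (A + p)%BZ (B + p * p)%BZ (Y + v)%BZ (C + p * v)%BZ
          (E + v * v)%BZ
      else k n A B Y C E in
    next (word_ge t w' cool.-1 (p + 1)%BZ) &&
    (if cool is 0%N then next (word_ge t w' 2 (p + 2)%BZ) else true)
  else misfit_ge t n A B Y C E.

Definition heavy (t : Z) (w : seq (option Z)) : bool :=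
  word_ge t w 0 0 0 0 0 0 0 0.

(* A sealed copy of [heavy]: conversion never evaluates it by accident. *)
Variant Heavy (t : Z) (w : seq (option Z)) : Prop := IsHeavy of heavy t w.

Local Arguments Z.add : simpl never.
Local Arguments Z.mul : simpl never.

(** Completing the square: [n * D] times the scaled residual of an arbitrary line [(a + b p) / G] is
    a sum of two nonnegative terms and [G * G] times the least squares numerator, so no line does
    better. *)
Lemma misfitP t n A B Y C E (G a b : Z) :
  (0 <= t)%BZ -> misfit_ge t n A B Y C E ->
  (G * G <= t * (G * G * E - 2 * G * (a * Y + b * C) + n * (a * a) + 2 * a * b * A
     + b * b * B))%BZ.
Proof.
move=> t0 /and3P[/Z.ltb_spec0 n0 /Z.ltb_spec0 D0 /Z.leb_spec0 le].
set D := (n * B - A * A)%BZ in D0 le.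
set K := (n * C - A * Y)%BZ in le.
set P := (X in (_ <= t * X)%BZ).
have E1 : (n * D * P = D * (n * a + A * b - G * Y) * (n * a + A * b - G * Y)
  + (D * b - G * K) * (D * b - G * K) + G * G * (D * (n * E - Y * Y) - K * K))%BZ.
  rewrite /P /K /D; lia.
have nD : (0 < n * D)%BZ by exact: Z.mul_pos_pos.
apply/(Z.mul_le_mono_pos_r _ _ _ nD).
have -> : (t * P * (n * D) = t * (n * D * P))%BZ by lia.
rewrite E1 -/D.
set u := (n * a + A * b - G * Y)%BZ; set v := (D * b - G * K)%BZ.
set Q := (D * (n * E - Y * Y) - K * K)%BZ in le *.
have -> : (t * (D * u * u + v * v + G * G * Q) =
  t * D * (u * u) + t * (v * v) + G * G * (t * Q))%BZ by lia.
have sq := Z.square_nonneg; have m0 := Z.mul_nonneg_nonneg.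
have u0 := m0 _ _ (m0 _ _ t0 (Z.lt_le_incl _ _ D0)) (sq u).
have v0 := m0 _ _ t0 (sq v).
have := Z.mul_le_mono_nonneg_l _ _ _ (sq G) le.
clear -u0 v0; lia.
Qed.

(** The pattern left by holes at least 4 apart: gaps are 1 or 2, and at most one of three
    consecutive gaps is 2. *)
Definition spaced (N : nat) (s : nat -> int) : Prop :=
  [/\ forall i, (i.+1 < N)%N -> (s i + 1 <= s i.+1) && (s i.+1 <= s i + 2),
      forall i, (i.+2 < N)%N -> s i.+2 <= s i + 3
    & forall i, (i.+3 < N)%N -> s i.+3 <= s i + 4].

(** The squared residual of [z i] against the line [(a + b s) / G], times [G ^+ 2] to stay in the
    integers. *)
Definition energy (G a b : int) (s z : nat -> int) (i : nat) : int :=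
  (G * z i - a - b * s i) ^+ 2.

(** Residuals scale quadratically, so words are matched up to a factor [kappa], in practice the
    value of an exception. *)
Fixpoint matches (z : nat -> int) (kappa : int) (i : nat) (w : seq (option Z)) :
    Prop :=
  if w is x :: w' then
    (if x is Some v then z i = kappa * int_of_Z v else True) /\
    matches z kappa i.+1 w'
  else True.

Lemma energy_ge0 G a b s z i : 0 <= energy G a b s z i.
Proof. exact: sqr_ge0. Qed.

Lemma Zle_mul_addr (t u v w : Z) :
  (0 <= t -> 0 <= v -> t * (u + w) <= t * (u + (v + w)))%BZ.
Proof. by move=> t0 v0; apply: Z.mul_le_mono_nonneg_l => //; lia. Qed.

(** Invariant of the recursion: the moments carry the letters already read, the remaining ones
    contribute their actual energies. Positions are measured from [sh], which turns the intercept
    into [a + b * sh]. *)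
Lemma word_geP (N : nat) (s z : nat -> int) (G a b sh kappa : int) (t : Z)
    (w : seq (option Z)) (cool : nat) (p n A B Y C E : Z) (i : nat) :
  let K := Z_of_int (kappa * G) in
  let a' := Z_of_int (a + b * sh) in
  let b' := Z_of_int b in
  (0 <= t)%BZ -> spaced N s ->
  word_ge t w cool p n A B Y C E ->
  (i + size w <= N)%N ->
  (w <> [::] -> p = Z_of_int (s i - sh)) ->
  (forall j, (j < cool)%N -> ((i + j).+1 < N)%N -> s (i + j).+1 = s (i + j)%N + 1) ->
  matches z kappa i w ->
  (K * K <= t * (K * K * E - 2 * K * (a' * Y + b' * C) + n * (a' * a')
     + 2 * a' * b' * A + b' * b' * B
     + Z_of_int (\sum_(i <= k < i + size w) energy G a b s z k)))%BZ.
Proof.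
move=> K a' b' t0 [s1 s2 s3].
elim: w cool p n A B Y C E i => [|x w IH] cool p n A B Y C E i /=.
  move=> chk _ _ _ _; have := @misfitP _ _ _ _ _ _ _ K a' b' t0 chk.
  by rewrite addn0 big_geq // Z.add_0_r.
move=> chk szN p_i cool_i [z_i z_w].
have {}p_i : p = Z_of_int (s i - sh) by exact: p_i.
have ZD (u v : int) : Z_of_int (u + v) = (Z_of_int u + Z_of_int v)%BZ by lia.
set e := Z_of_int (energy G a b s z i).
have e0 : (0 <= e)%BZ by have := energy_ge0 G a b s z i; rewrite /e; lia.
have split_sum : Z_of_int (\sum_(i <= k < i + (size w).+1) energy G a b s z k)
    = (e + Z_of_int (\sum_(i.+1 <= k < i.+1 + size w) energy G a b s z k))%BZ.
  rewrite big_ltn; last by lia.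
  by rewrite addnS addSn ZD.
rewrite split_sum => {split_sum}.
have step n' A' B' Y' C' E' :
    word_ge t w cool.-1 (p + 1)%BZ n' A' B' Y' C' E' &&
    (if cool is 0%N then word_ge t w 2 (p + 2)%BZ n' A' B' Y' C' E' else true) ->
  (K * K <= t * (K * K * E' - 2 * K * (a' * Y' + b' * C') + n' * (a' * a')
     + 2 * a' * b' * A' + b' * b' * B'
     + Z_of_int (\sum_(i.+1 <= k < i.+1 + size w) energy G a b s z k)))%BZ.
  clear chk z_i; case/andP=> chk1 chk2.
  (* After the last letter the next index may leave the range, but then no gap is read. *)
  have [w0|w0] : (w = [::]) \/ (i.+1 < N)%N.
  - by case: (w) szN => [|? ?] /= ?; [left|right; lia].
  - rewrite w0 /= in chk1 *; rewrite addn0 big_geq // Z.add_0_r.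
    exact: (@misfitP _ _ _ _ _ _ _ K a' b' t0 chk1).
  have [g1|g2] : s i.+1 = s i + 1 \/ s i.+1 = s i + 2 by have := s1 i w0; lia.
  - apply: (IH _ _ _ _ _ _ _ _ i.+1 chk1) => //; first by lia.
      by move=> _; rewrite p_i g1; lia.
    by move=> j jc jN; rewrite !addSnnS; apply: cool_i; lia.
  - case: cool cool_i chk1 chk2 => [|c] cool_i chk1 chk2; last first.
      by have := cool_i 0%N isT; rewrite addn0; lia.
    apply: (IH _ _ _ _ _ _ _ _ i.+1 chk2) => //; first by lia.
      by move=> _; rewrite p_i g2; lia.
    (* Two gaps sum to at most 3 and three to at most 4, so a gap 2 is followed by two gaps 1. *)
    case=> [|[|j]] // _; rewrite ?addn0 ?addn1 => jN.
      by have := s1 _ jN; have := s2 _ jN; lia.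
    have jN' : (i.+2 < N)%N by lia.
    by have := s1 _ jN'; have := s1 _ jN; have := s3 _ jN; lia.
(* An unconstrained letter leaves the moments alone; its energy is nonnegative and only helps. *)
case: x chk z_i => [v|] chk z_i; last first.
  by apply: Z.le_trans (step _ _ _ _ _ _ chk) _; apply: Zle_mul_addr.
have := step _ _ _ _ _ _ chk.
have -> : e = ((K * v - a' - b' * p) * (K * v - a' - b' * p))%BZ.
  rewrite /e /energy z_i /K /a' /b' p_i expr2; lia.
move=> le; apply: Z.le_trans le _.
apply: Z.eq_le_incl; congr Z.mul. lia.
Qed.

Lemma heavyP (N : nat) (s z : nat -> int) (G a b kappa : int) (t : Z)
    (w : seq (option Z)) (i : nat) :
  (0 <= t)%BZ -> spaced N s -> Heavy t w -> (i + size w <= N)%N ->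
  matches z kappa i w ->
  (kappa * G) ^+ 2 <= int_of_Z t * \sum_(i <= k < i + size w) energy G a b s z k.
Proof.
move=> t0 sp [hv] szN mt.
have := @word_geP N s z G a b (s i) kappa t w 0 0 0 0 0 0 0 0 i t0 sp hv szN.
have ZM (u v : int) : Z_of_int (u * v) = (Z_of_int u * Z_of_int v)%BZ by lia.
move=> /(_ _ _ mt); rewrite !(Z.mul_0_r, Z.mul_0_l, Z.add_0_l, Z.add_0_r) -ZM.
rewrite subrr -[t in (_ <= t * _)%BZ](int_of_ZK t) -ZM expr2 => le.
by have := le (fun _ => erefl) (fun _ => ltac:(by [])); lia.
Qed.

Lemma matches_cat z kappa i w1 w2 :
  matches z kappa i w1 -> matches z kappa (i + size w1) w2 ->
  matches z kappa i (w1 ++ w2).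
Proof.
elim: w1 i => [|x w1 IH] i /=; first by rewrite addn0.
by case=> xi m1 m2; split=> //; apply: IH; rewrite // addSnnS.
Qed.

Lemma matches_zeros (z : nat -> int) kappa i n :
  (forall k, (i <= k < i + n)%N -> z k = 0) ->
  matches z kappa i (nseq n (Some 0%BZ)).
Proof.
elim: n i => [|n IH] i //= z0; split; first by rewrite z0 ?mulr0 //; lia.
by apply: IH => k kn; apply: z0; lia.
Qed.

(** * Sequences at squared distance less than 1 from a line *)

Definition fits (N : nat) (s z : nat -> int) (G a b : int) : Prop :=
  0 < G /\ \sum_(0 <= k < N) energy G a b s z k < G ^+ 2.

(** Energies are nonnegative, so disjoint windows share the total; a single window is the case of an
    empty second one. *)
Lemma energy_window N s z G a b i j i' j' :
  fits N s z G a b -> (i <= j)%N -> (j <= i')%N -> (i' <= j')%N -> (j' <= N)%N ->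
  \sum_(i <= k < j) energy G a b s z k + \sum_(i' <= k < j') energy G a b s z k
    < G ^+ 2.
Proof.
move=> [_ tot] ij ji ij' jN.
pose S m n : int := \sum_(m <= k < n) energy G a b s z k.
rewrite -/(S _ _) -/(S _ _) -/(S _ _) in tot *.
have ge0 m n : 0 <= S m n by apply: sumr_ge0 => k _; apply: energy_ge0.
have cat m n p : (m <= n)%N -> (n <= p)%N -> S m p = S m n + S n p.
  exact: big_cat_nat.
have := ge0 0%N i; have := ge0 j i'; have := ge0 j' N.
have := cat 0%N i N; have := cat i j N; have := cat j i' N; have := cat i' j' N.
move: S {ge0 cat} tot => S; lia.
Qed.

Lemma heavy1_absurd N s z G a b kappa w i :
  spaced N s -> fits N s z G a b -> Heavy 1 w -> (i + size w <= N)%N ->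
  matches z kappa i w -> kappa = 0.
Proof.
move=> sp ft hv iN mt.
have := @heavyP N s z G a b kappa 1 w i Z.le_0_1 sp hv iN mt.
have := energy_window ft (leq_addr (size w) i) iN (leqnn N) (leqnn N).
rewrite [X in _ + X]big_geq // addr0 mul1r => lt le.
have {}lt := le_lt_trans le lt.
case: ft => G0 _.
by move: lt; rewrite exprMn -[X in _ < X]mul1r ltr_pM2r ?exprn_gt0 // !expr2; nia.
Qed.

Lemma heavy2_bound N s z G a b kappa w i :
  spaced N s -> fits N s z G a b -> Heavy 2 w -> (i + size w <= N)%N ->
  matches z kappa i w -> `|kappa| <= 1.
Proof.
move=> sp ft hv iN mt.
have := @heavyP N s z G a b kappa 2 w i Z.le_0_2 sp hv iN mt.
have := energy_window ft (leq_addr (size w) i) iN (leqnn N) (leqnn N).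
rewrite [X in _ + X]big_geq // addr0 => lt le.
have {le}lt : (kappa * G) ^+ 2 < 2 * G ^+ 2 by apply: le_lt_trans le _; lia.
case: ft => G0 _.
by move: lt; rewrite exprMn ltr_pM2r ?exprn_gt0 // !expr2; nia.
Qed.

(** Each word costs at least half of [G ^+ 2], which exhausts the strict bound on the total. *)
Lemma heavy2_disjoint N s z G a b kappa w i kappa' w' i' :
  spaced N s -> fits N s z G a b ->
  Heavy 2 w -> matches z kappa i w -> kappa <> 0 ->
  Heavy 2 w' -> matches z kappa' i' w' -> kappa' <> 0 ->
  (i + size w <= i')%N -> (i' + size w' <= N)%N -> False.
Proof.
move=> sp ft hv mt k0 hv' mt' k0' ii' iN.
have iN' : (i + size w <= N)%N by lia.
have le := @heavyP N s z G a b kappa 2 w i Z.le_0_2 sp hv iN' mt.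
have le' := @heavyP N s z G a b kappa' 2 w' i' Z.le_0_2 sp hv' iN mt'.
have := energy_window ft (leq_addr (size w) i) ii' (leq_addr (size w') i') iN.
case: ft => G0 _.
have sq (k : int) : k <> 0 -> G ^+ 2 <= (k * G) ^+ 2.
  move=> k1; have k2 : 1 <= k ^+ 2 by rewrite expr2; nia.
  by rewrite exprMn; apply: ler_peMl => //; apply: sqr_ge0.
have := sq _ k0; have := sq _ k0'; move: le le' => /=.
rewrite (_ : Posz (Pos.to_nat 2) = 2%:Z) //.
lia.
Qed.

(** * Words checked by computation *)

Definition zeros n : seq (option Z) := nseq n (Some 0%BZ).
Definition free n : seq (option Z) := nseq n None.
Definition one : option Z := Some 1%BZ.

Lemma matches_one (z : nat -> int) kappa i w :
  z i = kappa -> matches z kappa i.+1 w -> matches z kappa i (one :: w).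
Proof. by move=> zi zw; split; rewrite // zi; apply/esym/mulr1. Qed.

Lemma matches_nil z kappa i : matches z kappa i [::].
Proof. by []. Qed.
#[local] Hint Resolve matches_nil : core.

Lemma matches_free z kappa i n w :
  matches z kappa (i + n) w -> matches z kappa i (free n ++ w).
Proof.
elim: n i => [|n IH] i; first by rewrite addn0.
by rewrite -addSnnS => /IH.
Qed.

Lemma matches_some (z : nat -> int) kappa v i w :
  z i = kappa * int_of_Z v -> matches z kappa i.+1 w ->
  matches z kappa i (Some v :: w).
Proof. by []. Qed.

Lemma matches_zeros_cat (z : nat -> int) kappa i n w :
  (forall k, (i <= k < i + n)%N -> z k = 0) -> matches z kappa (i + n) w ->
  matches z kappa i (zeros n ++ w).
Proof.
move=> z0 zw; apply: matches_cat; first exact: matches_zeros.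
by rewrite size_nseq.
Qed.

Lemma matches_zeros_one (z : nat -> int) i n :
  (forall k, (i <= k < i + n)%N -> z k = 0) ->
  matches z (z (i + n)%N) i (zeros n ++ [:: one]).
Proof.
move=> z0; by apply: matches_zeros_cat => //; apply: matches_one.
Qed.

Lemma heavy_left_end : Heavy 2 (zeros 8 ++ [:: one]).
Proof. by split; vm_compute. Qed.

Lemma heavy_right_end : Heavy 2 (one :: zeros 8).
Proof. by split; vm_compute. Qed.

(** The free letter stands for a first exception of any size; this bounds a second one independently
    of it. *)
Lemma heavy_probe j : (j < 8)%N ->
  Heavy 2 (zeros 12 ++ free 1 ++ zeros j ++ [:: one]).
Proof.
move=> j8; split; move: j j8.
have: all (fun j => heavy 2 (zeros 12 ++ free 1 ++ zeros j ++ [:: one])) (iota 0 8).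
  by vm_compute.
by move=> /allP h j j8; apply: h; rewrite mem_iota.
Qed.

Lemma heavy_probe2 : Heavy 2 (zeros 12 ++ free 2 ++ [:: one]).
Proof. by split; vm_compute. Qed.

(** Adjacent exceptions ([j = 0]) are treated apart: opposite signs by [heavy_updown], equal signs
    with a third value, right of them or left of the zeros. *)
Lemma heavy_pair (x : Z) j : x \in [:: 1; -1]%BZ -> (0 < j < 8)%N ->
  Heavy 1 (zeros 12 ++ one :: zeros j ++ [:: Some x]).
Proof.
move=> xin j8; split; move: j j8.
suff /allP h : all (fun j => heavy 1 (zeros 12 ++ one :: zeros j ++ [:: Some x]))
    (iota 1 7).
  by move=> j j8; apply: h; rewrite mem_iota.
by move: xin; rewrite !inE => /orP[] /eqP->; vm_compute.
Qed.

Lemma heavy_updown : Heavy 1 (zeros 12 ++ [:: one; Some (-1)%BZ]).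
Proof. by split; vm_compute. Qed.

Lemma heavy_step_right (x : Z) : x \in [:: 1; 0; -1]%BZ ->
  Heavy 1 (zeros 12 ++ [:: one; one; Some x]).
Proof. by rewrite !inE => /or3P[] /eqP->; split; vm_compute. Qed.

Lemma heavy_step_left (x : Z) : x \in [:: 1; 0; -1]%BZ ->
  Heavy 1 (Some x :: zeros 12 ++ [:: one; one]).
Proof. by rewrite !inE => /or3P[] /eqP->; split; vm_compute. Qed.

(** For exceptions on both sides of a window of 12 zeros; from 16 zeros on, two disjoint words with
    eight zeros each take over. *)
Lemma heavy_gap (x : Z) j : x \in [:: 1; -1]%BZ -> (12 <= j < 16)%N ->
  Heavy 1 (one :: zeros j ++ [:: Some x]).
Proof.
move=> xin j8; split; move: j j8.
suff /allP h : all (fun j => heavy 1 (one :: zeros j ++ [:: Some x])) (iota 12 4).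
  by move=> j j8; apply: h; rewrite mem_iota.
by move: xin; rewrite !inE => /orP[] /eqP->; vm_compute.
Qed.

(** * At most one exceptional value *)

Lemma norm1_cases (x y : int) : x <> 0 -> `|x| <= 1 -> `|y| <= 1 ->
  exists2 v : Z, v \in [:: 1; 0; -1]%BZ & y = x * int_of_Z v.
Proof.
move=> x0 x1 y1; have [->|[->|->]] : y = x \/ y = 0 \/ y = - x by lia.
- by exists 1%BZ; rewrite ?inE //= mulr1.
- by exists 0%BZ; rewrite ?inE //= mulr0.
- by exists (-1)%BZ; rewrite ?inE //= mulrN1.
Qed.

Lemma norm1_nz_cases (x y : int) : x <> 0 -> y <> 0 -> `|x| <= 1 -> `|y| <= 1 ->
  exists2 v : Z, v \in [:: 1; -1]%BZ & y = x * int_of_Z v.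
Proof.
move=> x0 y0 x1 y1; have [v] := norm1_cases x0 x1 y1.
rewrite !inE => /or3P[] /eqP-> yE; last by exists (-1)%BZ; rewrite ?inE.
- by exists 1%BZ; rewrite ?inE.
- by rewrite yE /= mulr0 in y0.
Qed.

(** Let [j] zeros separate the two exceptions. For [j >= 8] each ends its own word of eight zeros,
    at cost 1/2 apiece. For smaller [j] both values are 1 or -1 and the finite checks apply. *)
Lemma no_second_exception N s z G a b i q :
  (48 <= N)%N -> spaced N s -> fits N s z G a b ->
  (forall k, (i <= k < i + 12)%N -> z k = 0) -> z (i + 12)%N <> 0 ->
  (i + 12 < q < N)%N -> (forall k, (i + 12 < k < q)%N -> z k = 0) -> z q = 0.
Proof.
move=> N48 sp ft zi zp pq zq; apply/eqP; case: eqP => // zq0; exfalso.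
have h8 := heavy_left_end.
have mp : matches z (z (i + 12)%N) (i + 4) (zeros 8 ++ [:: one]).
  have := @matches_zeros_one z (i + 4) 8; rewrite -addnA; apply.
  by move=> k kk; apply: zi; lia.
have szE n : size (zeros n ++ [:: one]) = n.+1 by rewrite size_cat size_nseq addn1.
have zp1 : `|z (i + 12)%N| <= 1.
  by apply: (heavy2_bound sp ft h8 _ mp); rewrite szE; lia.
have [j qE] : exists j, q = ((i + 12).+1 + j)%N by exists (q - (i + 13))%N; lia.
have zj k : ((i + 12).+1 <= k < (i + 12).+1 + j)%N -> z k = 0.
  by move=> kk; apply: zq; lia.
have [j8|j8] := leqP 8 j.
  have mq : matches z (z q) (q - 8) (zeros 8 ++ [:: one]).
    have := @matches_zeros_one z (q - 8) 8; rewrite subnK; last by lia.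
    by apply=> k kk; apply: zq; lia.
  by apply: (heavy2_disjoint sp ft h8 mp zp h8 mq zq0); rewrite szE; lia.
(* The first exception is left free, as its ratio to [z q] is not known yet. *)
have zq1 : `|z q| <= 1.
  apply: (heavy2_bound (i := i) sp ft (heavy_probe j8)).
    by rewrite !size_cat !size_nseq /=; lia.
  apply: (matches_zeros_cat zi); apply: matches_free; rewrite addn1.
  apply: (matches_zeros_cat zj); rewrite -qE.
  exact: matches_one erefl (matches_nil _ _ _).
have [v vin zqE] := norm1_nz_cases zp zq0 zp1 zq1.
have [j0|j0] := posnP j; last first.
  have hv := heavy_pair vin (introT andP (conj j0 j8)).
  apply: zp; apply: (heavy1_absurd sp ft hv (i := i)).
    by rewrite !size_cat /= !size_cat !size_nseq /=; lia.
  apply: (matches_zeros_cat zi); apply: matches_one => //.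
  by apply: (matches_zeros_cat zj); rewrite -qE; apply: matches_some.
have {zj j8}qE : q = (i + 12).+1 by rewrite qE j0 addn0.
move: vin; rewrite !inE => /orP[] /eqP vE; last first.
  apply: zp; apply: (heavy1_absurd sp ft heavy_updown (i := i)).
    by rewrite size_cat size_nseq /=; lia.
  apply: (matches_zeros_cat zi); apply: matches_one => //.
  by rewrite -qE; apply: matches_some; rewrite // zqE vE.
rewrite vE [RHS]mulr1 in zqE.
have [q1|q1] := leqP q.+2 N.
- have zq2 : `|z q.+1| <= 1.
    apply: (heavy2_bound sp ft heavy_probe2 (i := i)).
      by rewrite !size_cat !size_nseq /=; lia.
    apply: (matches_zeros_cat zi); apply: matches_free.
    by rewrite addn2 -qE; apply: matches_one.
  have [v' /heavy_step_right hv vE'] := norm1_cases zp zp1 zq2.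
  apply: zp; apply: (heavy1_absurd sp ft hv (i := i)).
    by rewrite size_cat size_nseq /=; lia.
  apply: (matches_zeros_cat zi); apply: matches_one => //; rewrite -qE.
  by apply: matches_one => //; apply: matches_some.
(* Here [q] is the last index, so the third value is read just left of the zeros; [i = N - 14] is
   positive. *)
- have [i' iE] : exists i', i = i'.+1 by exists i.-1; lia.
  have zi1 : `|z i'| <= 1.
    apply: (heavy2_bound (i := i') sp ft heavy_right_end); first by rewrite /=; lia.
    apply: matches_one => //.
    by apply: matches_zeros => k kk; apply: zi; lia.
  have [v' /heavy_step_left hv vE'] := norm1_cases zp zp1 zi1.
  apply: zp; apply: (heavy1_absurd sp ft hv (i := i')).
    by rewrite /=; lia.
  apply: matches_some => //; rewrite -iE; apply: (matches_zeros_cat zi).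
  by apply: matches_one => //; rewrite -qE; apply: matches_one.
Qed.

Lemma exception_right N s z G a b w :
  (48 <= N)%N -> spaced N s -> fits N s z G a b -> (w + 12 <= N)%N ->
  (forall k, (w <= k < w + 12)%N -> z k = 0) ->
  exists2 p, (w + 12 <= p)%N & forall k, (w <= k < N)%N -> k != p -> z k = 0.
Proof.
move=> N48 sp ft wN zw.
pose P k := (w + 12 <= k < N)%N && (z k != 0).
have [/hasP[k0 _ Pk0]|/hasPn noP] := boolP (has P (iota 0 N)); last first.
  (* An index outside the range encodes that there is no exception. *)
  exists N => [//|k kN _]; have [k12|k12] := ltnP k (w + 12).
    by apply: zw; lia.
  by apply/eqP; apply: contraT => zk; have := noP k; rewrite mem_iota /P zk; lia.
have [p /andP[pN zp] min_p] := ex_minnP (ex_intro P k0 Pk0).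
exists p => [|k kN kp]; first by lia.
have z0 m : (w <= m < p)%N -> z m = 0.
  move=> mp; have [m12|m12] := ltnP m (w + 12); first by apply: zw; lia.
  apply/eqP; apply: contraT => zm.
  by have := min_p m; rewrite /P zm; lia.
have [kp'|pk] := ltnP k p; first by apply: z0; lia.
have {kp}pk : (p < k)%N by lia.
(* All values from [w] up to [p] vanish, so the window can be moved to the 12 indices just before
   the first exception; strong induction clears what follows. *)
have [i pE] : exists i, p = (i + 12)%N by exists (p - 12)%N; lia.
move: k {kN}(proj2 (andP kN)) pk; elim/ltn_ind => k IH kN pk.
rewrite pE in pN zp z0 pk IH.
apply: (no_second_exception N48 sp ft (i := i)) => [m mi||//|m mk].
- by apply: z0; lia.
- by apply/eqP.
- by rewrite pk kN.
- by apply: IH; lia.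
Qed.

(** Reversing the indices and negating [s] keeps it increasing; this reduces the left side of a
    window to the right side. *)
Definition flip (N : nat) (f : nat -> int) (k : nat) : int := f (N - k.+1)%N.

Lemma spaced_flip N s : spaced N s -> spaced N (fun k => - flip N s k).
Proof.
rewrite /flip => -[s1 s2 s3]; split=> i iN.
- have := s1 (N - i.+2)%N; rewrite (_ : (N - i.+2).+1 = (N - i.+1)%N); last by lia.
  by move=> /(_ _); lia.
- have := s2 (N - i.+3)%N; rewrite (_ : (N - i.+3).+2 = (N - i.+1)%N); last by lia.
  by move=> /(_ _); lia.
- have := s3 (N - i.+4)%N; rewrite (_ : (N - i.+4).+3 = (N - i.+1)%N); last by lia.
  by move=> /(_ _); lia.
Qed.

Lemma fits_flip N s z G a b :
  fits N s z G a b -> fits N (fun k => - flip N s k) (flip N z) G a (- b).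
Proof.
case=> G0 tot; split=> //; apply: le_lt_trans tot.
rewrite [X in _ <= X]big_nat_rev /= le_eqVlt; apply/orP; left; apply/eqP.
by apply: eq_bigr => k _; rewrite /energy /flip add0n mulrNN.
Qed.

Lemma exception_left N s z G a b w :
  (48 <= N)%N -> spaced N s -> fits N s z G a b -> (w + 12 <= N)%N ->
  (forall k, (w <= k < w + 12)%N -> z k = 0) ->
  (forall k, (k < w + 12)%N -> z k = 0) \/
  exists2 l, (l < w)%N & forall k, (k < w + 12)%N -> k != l -> z k = 0.
Proof.
move=> N48 sp ft wN zw.
have zw' k : (N - w - 12 <= k < N - w - 12 + 12)%N -> flip N z k = 0.
  by move=> kw; apply: zw; lia.
have wN' : (N - w - 12 + 12 <= N)%N by lia.
have [p pw zp] := exception_right N48 (spaced_flip sp) (fits_flip ft) wN' zw'.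
have zk k : (k < w + 12)%N -> k != (N - p.+1)%N \/ (N <= p)%N -> z k = 0.
  move=> kw kp; have := zp (N - k.+1)%N; rewrite /flip.
  by rewrite (_ : (N - (N - k.+1).+1)%N = k); [apply; lia | lia].
have [Np|pN] := leqP N p; first by left=> k kw; apply: zk => //; right.
by right; exists (N - p.+1)%N => [|k kw kl]; [lia | apply: zk => //; left].
Qed.

(** Each side of the window has at most one exception, of absolute value at most 1, and exceptions
    on both sides together would be too costly. *)
Lemma sparse_exceptions N s z G a b w :
  (48 <= N)%N -> spaced N s -> fits N s z G a b -> (w + 12 <= N)%N ->
  (forall k, (w <= k < w + 12)%N -> z k = 0) ->
  exists j, forall k, (k < N)%N -> `|z k| <= (k == j).
Proof.
move=> N48 sp ft wN zw.
have [p pw zp] := exception_right N48 sp ft wN zw.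
have zp8 : (p < N)%N -> matches z (z p) (p - 8) (zeros 8 ++ [:: one]).
  move=> pN; have := @matches_zeros_one z (p - 8) 8; rewrite subnK; last by lia.
  by apply=> k kp; apply: zp; lia.
have zp1 : (p < N)%N -> `|z p| <= 1.
  move=> pN; apply: (heavy2_bound sp ft heavy_left_end _ (zp8 pN)).
  by rewrite /=; lia.
have [zl|[l lw zl]] := exception_left N48 sp ft wN zw.
  exists p => k kN; case: eqP => [kp|/eqP kp]; first by rewrite kp in kN *; apply: zp1.
  have [kw|kw] := ltnP k (w + 12); first by rewrite zl.
  by rewrite zp // kN andbT; lia.
have z0 k : (k < N)%N -> k != l -> k != p -> z k = 0.
  move=> kN kl kp; have [kw|kw] := ltnP k (w + 12); first by rewrite zl.
  by rewrite zp // kN andbT; lia.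
have zl8 : matches z (z l) l (one :: zeros 8).
  by apply: matches_one => //; apply: matches_zeros => k kl; apply: zl; lia.
have zl1 : `|z l| <= 1.
  by apply: (heavy2_bound sp ft heavy_right_end _ zl8); rewrite /=; lia.
have [zl0|/eqP zl0] := eqVneq (z l) 0.
  exists p => k kN; case: eqP => [kp|/eqP kp]; first by rewrite kp in kN *; apply: zp1.
  by have [->|kl] := eqVneq k l; rewrite ?zl0 // z0.
exists l => k kN; case: eqP => [->//|/eqP kl].
have [kp|kp] := eqVneq k p; last by rewrite z0.
have [->//|/eqP zk0] := eqVneq (z k) 0; exfalso; rewrite {k}kp in kN kl zk0.
(* At least 16 zeros in between leave room for two disjoint words; otherwise there are 12 to 15
   zeros. *)
have [far|near] := leqP (l + 17) p.
  apply: (heavy2_disjoint sp ft heavy_right_end zl8 zl0 heavy_left_end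
    (zp8 kN) zk0); rewrite /=; lia.
have [v vin zpE] := norm1_nz_cases zl0 zk0 zl1 (zp1 kN).
have jE : (12 <= p - l.+1 < 16)%N by lia.
apply: zl0; apply: (heavy1_absurd sp ft (heavy_gap vin jE) (i := l)).
  by rewrite /= size_cat size_nseq /=; lia.
apply: matches_one => //; apply: matches_zeros_cat.
  by move=> m ml; apply: z0; lia.
by rewrite subnKC; [apply: matches_some | lia].
Qed.

(** * A window on which the sequence is affine *)

Lemma light_window N s z G a b : (48 <= N)%N -> fits N s z G a b ->
  exists2 w, (w + 12 <= N)%N &
    4 * \sum_(w <= k < w + 12) energy G a b s z k < G ^+ 2.
Proof.
move=> N48 [_ tot]; pose S m n : int := \sum_(m <= k < n) energy G a b s z k.
rewrite -/(S _ _) in tot.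
have ge0 m n : 0 <= S m n by apply: sumr_ge0 => k _; apply: energy_ge0.
have cat m n p : (m <= n)%N -> (n <= p)%N -> S m p = S m n + S n p.
  exact: big_cat_nat.
have [lt|] := ltP (4 * S 0%N 12%N) (G ^+ 2); first by exists 0%N => //; lia.
have [lt|] := ltP (4 * S 12%N 24%N) (G ^+ 2); first by exists 12%N => //; lia.
have [lt|] := ltP (4 * S 24%N 36%N) (G ^+ 2); first by exists 24%N => //; lia.
have [lt|] := ltP (4 * S 36%N 48%N) (G ^+ 2); first by exists 36%N => //; lia.
have := cat 0%N 12%N N; have := cat 12%N 24%N N; have := cat 24%N 36%N N.
have := cat 36%N 48%N N; have := ge0 48%N N; move: S {ge0 cat} tot => S; lia.
Qed.

Lemma energy_sub G a b s z (l r : seq nat) : uniq l -> {subset l <= r} ->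
  \sum_(k <- l) energy G a b s z k <= \sum_(k <- r) energy G a b s z k.
Proof.
elim: l r => [|x l IH] r /=.
  by move=> _ _; rewrite big_nil; apply: sumr_ge0 => k _; apply: energy_ge0.
case/andP=> xl ul lr; have xr : x \in r by apply: lr; rewrite mem_head.
rewrite big_cons (big_rem x xr) lerD2l; apply: IH => // k kl.
have : k \in r by apply: lr; rewrite inE kl orbT.
rewrite (perm_mem (perm_to_rem xr)) inE => /orP[/eqP kx|]; last by [].
by rewrite -kx kl in xl.
Qed.

(* The vector [e_i - e_j - e_k + e_l] has norm 4 and lies in the lattice; by
   Cauchy-Schwarz the functional takes on it an integer value less than 1. *)
Lemma quad_zero s z G a b w i j k l :
  0 < G -> 4 * \sum_(w <= m < w + 12) energy G a b s z m < G ^+ 2 ->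
  uniq [:: i; j; k; l] -> all (fun m => w <= m < w + 12)%N [:: i; j; k; l] ->
  s i + s l = s j + s k -> z i + z l = z j + z k.
Proof.
move=> G0 light un inw s_eq.
have sub : {subset [:: i; j; k; l] <= index_iota w (w + 12)}.
  by move=> m /(allP inw); rewrite mem_index_iota.
have := @energy_sub G a b s z _ _ un sub.
rewrite !big_cons big_nil addr0 /energy => le.
set ri := G * z i - _ - _ in le; set rj := G * z j - _ - _ in le.
set rk := G * z k - _ - _ in le; set rl := G * z l - _ - _ in le.
have sumE : G * (z i + z l - z j - z k) = ri + rl - rj - rk.
  have sE : s i = s j + s k - s l by lia.
  by rewrite /ri /rj /rk /rl sE; ring.
have cs : (ri + rl - rj - rk) ^+ 2 <= 4 * (ri ^+ 2 + (rj ^+ 2 + (rk ^+ 2 + rl ^+ 2))).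
  have -> : 4 * (ri ^+ 2 + (rj ^+ 2 + (rk ^+ 2 + rl ^+ 2))) =
    (ri + rl - rj - rk) ^+ 2 + ((ri - rl) ^+ 2 + (ri + rj) ^+ 2 + (ri + rk) ^+ 2
     + (rl + rj) ^+ 2 + (rl + rk) ^+ 2 + (rj - rk) ^+ 2) by ring.
  by rewrite lerDl !addr_ge0 ?sqr_ge0.
rewrite -sumE in cs.
set v := z i + z l - z j - z k in cs.
have : (G * v) ^+ 2 < G ^+ 2.
  by apply: le_lt_trans cs (le_lt_trans _ light); rewrite ler_pM2l.
rewrite exprMn -[X in _ < X]mulr1 ltr_pM2l ?exprn_gt0 // => v1.
suff : v = 0 by rewrite /v; clear; lia.
move: v v1 {cs sumE} => v; rewrite expr2; clear; nia.
Qed.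

(** Quadruples with [s i + s l = s j + s k] compare increments of [z]. Unit gaps without a common
    end compare directly, adjacent ones through a third, and a gap 2 with two successive unit gaps;
    12 points leave room for this on one side or the other. *)
Lemma affine_window N s z G a b w :
  spaced N s -> 0 < G -> (w + 12 <= N)%N ->
  4 * \sum_(w <= m < w + 12) energy G a b s z m < G ^+ 2 ->
  exists c e, forall k, (w <= k < w + 12)%N -> z k = c + e * s k.
Proof.
move=> [s1 s2 s3] G0 wN light.
have quad i j k l : uniq [:: i; j; k; l] ->
    all (fun m => w <= m < w + 12)%N [:: i; j; k; l] ->
    s i + s l = s j + s k -> z i + z l = z j + z k.
  exact: quad_zero light.
have g12 i : (i.+1 < N)%N -> s i.+1 = s i + 1 \/ s i.+1 = s i + 2.
  by move=> iN; have := s1 i iN; lia.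
have next1 i : (i.+2 < N)%N -> s i.+1 = s i + 2 -> s i.+2 = s i.+1 + 1.
  by move=> iN; have := s2 i iN; have := s1 i.+1 iN; lia.
have next2 i : (i.+3 < N)%N -> s i.+1 = s i + 2 -> s i.+3 = s i.+2 + 1.
  by move=> iN; have := s3 i iN; have := s1 i.+1; have := s1 i.+2 iN; lia.
have far i j : (w <= i)%N -> (i.+2 <= j)%N -> (j < w + 11)%N ->
    s i.+1 = s i + 1 -> s j.+1 = s j + 1 -> z j.+1 - z j = z i.+1 - z i.
  move=> wi ij jw si sj; have := quad i i.+1 j j.+1.
  by rewrite /= !inE; lia.
have near i : (w <= i)%N -> (i.+1 < w + 11)%N ->
    s i.+1 = s i + 1 -> s i.+2 = s i.+1 + 1 -> z i.+2 - z i.+1 = z i.+1 - z i.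
  move=> wi iw si si1; have [iw5|iw5] := leqP i (w + 5).
    have [s4|s4] := g12 i.+3 ltac:(lia).
      by have := far i i.+3; have := far i.+1 i.+3; lia.
    by have := next1 i.+3; have := far i i.+4; have := far i.+1 i.+4; lia.
  have [m mE] : exists m, i = m.+3 by exists (i - 3)%N; lia.
  subst i; have [sm|sm] := g12 m ltac:(lia).
    by have := far m m.+3; have := far m m.+4; lia.
  by have := next1 m; have := far m.+1 m.+3; have := far m.+1 m.+4; lia.
have unit_gap i j : (w <= i <= j)%N -> (j < w + 11)%N ->
    s i.+1 = s i + 1 -> s j.+1 = s j + 1 -> z j.+1 - z j = z i.+1 - z i.
  move=> wij jw si sj; have [ij|ij] := leqP i.+2 j; first by apply: far; lia.
  have [<-//|ji] : i = j \/ j = i.+1 by lia.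
  by subst j; apply: near; lia.
(* Two successive gaps are not both 2, so one of the first two is a unit gap; it fixes the slope
   [d]. *)
have [e [e0 [ew es]]] : exists e, (w <= e)%N /\ (e <= w.+1)%N /\ s e.+1 = s e + 1.
  have [sw|sw] := g12 w ltac:(lia); first by exists w; lia.
  by exists w.+1; have := next1 w; lia.
pose d := z e.+1 - z e.
have gap1 k : (w <= k)%N -> (k < w + 11)%N -> s k.+1 = s k + 1 -> z k.+1 - z k = d.
  move=> wk kw sk; have [ek|ke] := leqP e k; first by apply: unit_gap; lia.
  by apply/esym; apply: unit_gap; lia.
have gap2 k : (w <= k)%N -> (k < w + 11)%N -> s k.+1 = s k + 2 ->
    z k.+1 - z k = d * 2.
  move=> wk kw sk; have [kw5|kw5] := leqP k (w + 5).
    have sk2 := next2 k; have [sk3|sk3] := g12 k.+3 ltac:(lia).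
      have := quad k k.+1 k.+2 k.+4; rewrite /= !inE.
      by have := gap1 k.+2; have := gap1 k.+3; lia.
    have := quad k k.+1 k.+4 k.+4.+2; rewrite /= !inE.
    have := next1 k.+3; have := next2 k.+3.
    by have := gap1 k.+4; have := gap1 k.+4.+1; lia.
  have [m mE] : exists m, k = m.+4.+1 by exists (k - 5)%N; lia.
  subst k; have sm3 : s m.+4 = s m.+3 + 1.
    by have [//|sm3] := g12 m.+3 ltac:(lia); have := next2 m.+3; have := next1 m.+4; lia.
  have sm4 : s m.+4.+1 = s m.+4 + 1.
    by have [//|sm4] := g12 m.+4 ltac:(lia); have := next1 m.+4; lia.
  have [sm2|sm2] := g12 m.+2 ltac:(lia).
    have := quad m.+2 m.+4 m.+4.+1 m.+4.+2; rewrite /= !inE.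
    by have := gap1 m.+2; have := gap1 m.+3; lia.
  have sm1 : s m.+2 = s m.+1 + 1.
    by have [//|sm1] := g12 m.+1 ltac:(lia); have := next1 m.+1; lia.
  have sm0 : s m.+1 = s m + 1.
    by have [//|sm0] := g12 m ltac:(lia); have := next2 m; lia.
  have := quad m m.+2 m.+4.+1 m.+4.+2; rewrite /= !inE.
  by have := gap1 m; have := gap1 m.+1; lia.
exists (z w - d * s w), d => k /andP[wk kw].
have [j kE] : exists j, k = (w + j)%N by exists (k - w)%N; lia.
subst k; elim: j {wk} kw => [|j IH]; first by rewrite addn0 subrK.
rewrite addnS => jw; have {}IH := IH (ltnW jw).
have [sj|sj] := g12 (w + j)%N ltac:(lia).
  by have := gap1 (w + j)%N; rewrite sj mulrDr; lia.
by have := gap2 (w + j)%N; rewrite sj mulrDr; lia.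
Qed.

Lemma near_affine N s y G a b :
  (48 <= N)%N -> spaced N s -> fits N s y G a b ->
  exists c e j, forall k, (k < N)%N -> `|y k - c - e * s k| <= (k == j).
Proof.
move=> N48 sp ft; have [w wN light] := light_window N48 ft.
have [G0 tot] := ft.
have [c [e yw]] := affine_window sp G0 wN light.
pose z k := y k - c - e * s k.
(* Subtracting an affine function changes the coefficients of the line but not the energies. *)
have ftz : fits N s z G (a - G * c) (b - G * e).
  split=> //; congr (_ < _): tot; apply: eq_bigr => k _.
  by rewrite /energy /z; congr (_ ^+ 2); ring.
have zw k : (w <= k < w + 12)%N -> z k = 0 by move=> /yw; rewrite /z; lia.
have [j zj] := sparse_exceptions N48 sp ftz wN zw.
by exists c, e, j.
Qed.

(** * The lattice and additive functionals on it *)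

Lemma sum_lin3 (I : finType) (p a b : int) (F1 F2 F3 : I -> int) :
  \sum_i (p * F1 i - a * F2 i - b * F3 i)
    = p * (\sum_i F1 i) - a * (\sum_i F2 i) - b * (\sum_i F3 i).
Proof. by rewrite !mulr_sumr !sumrB. Qed.

Lemma inLP (d : nat) (h : seq nat) (x : 'rV[int]_(d + 2)) :
  reflect (\sum_i x 0 i = 0 /\ \sum_(i < d + 2) (Defs.sval d h i)%:Z * x 0 i = 0)
          (inL d h x).
Proof. by apply: (iffP andP) => -[/eqP ? /eqP ?]. Qed.

Lemma inLD d h x y : inL d h x -> inL d h y -> inL d h (x + y).
Proof.
move=> /inLP[x1 x2] /inLP[y1 y2]; apply/inLP; split.
  by under eq_bigr do rewrite mxE; rewrite big_split /= x1 y1.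
by under eq_bigr do rewrite mxE mulrDr; rewrite big_split /= x2 y2.
Qed.

Lemma inLZ d h (k : int) x : inL d h x -> inL d h (k *: x).
Proof.
move=> /inLP[x1 x2]; apply/inLP; split.
  by under eq_bigr do rewrite mxE; rewrite -mulr_sumr x1 mulr0.
by under eq_bigr do rewrite mxE mulrCA; rewrite -mulr_sumr x2 mulr0.
Qed.

Lemma inL0 d h : inL d h 0.
Proof. by apply/inLP; split; rewrite big1 // => i _; rewrite mxE ?mulr0. Qed.

Lemma inL_sum d h (I : Type) (r : seq I) (F : I -> 'rV[int]_(d + 2)) :
  (forall i, inL d h (F i)) -> inL d h (\sum_(i <- r) F i).
Proof. by move=> LF; elim/big_ind: _ => //; [exact: inL0 | exact: inLD]. Qed.

Lemma dotZ_ge0 n (x : 'rV[int]_n) : 0 <= dotZ x x.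
Proof. by apply: sumr_ge0 => i _; rewrite -expr2 sqr_ge0. Qed.

Lemma dotZ_eq0 n (x : 'rV[int]_n) : dotZ x x = 0 -> x = 0.
Proof.
move=> /eqP; rewrite psumr_eq0 => [/allP x0|i _]; last by rewrite -expr2 sqr_ge0.
apply/rowP => i; rewrite mxE; apply/eqP.
by have := x0 i (mem_index_enum i); rewrite /= mulf_eq0 orbb.
Qed.

Lemma dotZ_coord n (x : 'rV[int]_n) j :
  dotZ x x = (x 0 j) ^+ 2 + \sum_(i < n | i != j) (x 0 i) ^+ 2.
Proof. by rewrite /dotZ (bigD1 j). Qed.

Section AdditiveOnL.
Variables (d : nat) (h : seq nat) (f : 'rV[int]_(d + 2) -> int).
Hypothesis fD : forall x y, inL d h x -> inL d h y -> f (x + y) = f x + f y.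

Lemma addL0 : f 0 = 0.
Proof. by have := fD (inL0 d h) (inL0 d h); rewrite addr0; lia. Qed.

Lemma addLMn x k : inL d h x -> f (x *+ k) = f x *+ k.
Proof.
move=> Lx; elim: k => [|k IH]; first by rewrite addL0.
by rewrite !mulrS fD ?IH // -scaler_nat; apply: inLZ.
Qed.

Lemma addLZ k x : inL d h x -> f (k *: x) = k * f x.
Proof.
have pos m y : inL d h y -> f (m%:Z *: y) = m%:Z * f y.
  by move=> Ly; rewrite -natz scaler_nat addLMn // mulr_natl.
move=> Lx; case: (intP k) => [|m|m]; rewrite ?scale0r ?addL0 ?mul0r ?pos //.
have Lm : inL d h (m.+1%:Z *: x) by apply: inLZ.
have := fD Lm (inLZ (-1) Lm); rewrite scalerA mulN1r -scalerDl subrr scale0r addL0.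
rewrite pos // => /esym/eqP; rewrite addrC addr_eq0 => /eqP->.
by rewrite mulNr.
Qed.

Lemma addL_sum (I : Type) (r : seq I) (F : I -> 'rV[int]_(d + 2)) :
  (forall i, inL d h (F i)) -> f (\sum_(i <- r) F i) = \sum_(i <- r) f (F i).
Proof.
move=> LF; elim: r => [|i r IH]; first by rewrite !big_nil addL0.
by rewrite !big_cons fD ?IH //; apply: inL_sum.
Qed.

End AdditiveOnL.

(* [e_i + (s_i - s_i0 - 1) e_i0 + (s_i0 - s_i) e_i1], in the lattice when
   [s_i1 = s_i0 + 1]. *)
Definition relvec {N : nat} (s : nat -> int) (i0 i1 i : 'I_N) : 'rV[int]_N :=
  \row_j ((j == i)%:R + (s i - s i0 - 1) * (j == i0)%:R + (s i0 - s i) * (j == i1)%:R).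

Lemma sum_relvec N s (i0 i1 i : 'I_N) (F : 'I_N -> int) :
  \sum_j F j * relvec s i0 i1 i 0 j
    = F i + (s i - s i0 - 1) * F i0 + (s i0 - s i) * F i1.
Proof.
have pick k : \sum_j F j * (j == k)%:R = F k.
  rewrite (bigD1 k) //= eqxx mulr1 big1 ?addr0 // => j /negPf->.
  by rewrite mulr0.
under eq_bigr do rewrite mxE !mulrDr mulrCA [F _ * ((s i0 - _) * _)]mulrCA.
by rewrite !big_split /= -!mulr_sumr !pick.
Qed.

Lemma inL_relvec d h (i0 i1 i : 'I_(d + 2)) :
  (Defs.sval d h i1)%:Z = (Defs.sval d h i0)%:Z + 1 ->
  inL d h (relvec (fun k => (Defs.sval d h k)%:Z) i0 i1 i).
Proof.
move=> s1; set v := relvec _ _ _ _; apply/inLP; split.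
  have := sum_relvec (fun k => (Defs.sval d h k)%:Z) i0 i1 i (fun=> 1).
  by under eq_bigr do rewrite mul1r; rewrite -/v => ->; lia.
have -> := sum_relvec (fun k => (Defs.sval d h k)%:Z) i0 i1 i
  (fun k => (Defs.sval d h k)%:Z).
by rewrite s1; ring.
Qed.

(** The surplus coefficients at [i0] and [i1] are combinations of the two sums that vanish on the
    lattice. *)
Lemma relvec_span d h (i0 i1 : 'I_(d + 2)) x :
  (Defs.sval d h i1)%:Z = (Defs.sval d h i0)%:Z + 1 -> inL d h x ->
  x = \sum_i x 0 i *: relvec (fun k => (Defs.sval d h k)%:Z) i0 i1 i.
Proof.
move=> s1 /inLP[x1 x2]; apply/rowP => j; rewrite summxE.
set s := fun k => (Defs.sval d h k)%:Z in x2 s1 *.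
under eq_bigr do rewrite !mxE.
rewrite (eq_bigr (fun i => x 0 i * (j == i)%:R
   + (s i * x 0 i - (s i0 + 1) * x 0 i) * (j == i0)%:R
   + (s i0 * x 0 i - s i * x 0 i) * (j == i1)%:R)); last first.
  by move=> i _; rewrite /s; ring.
rewrite !big_split /= -!mulr_suml !sumrB -!mulr_sumr x1 x2 !mulr0 subrr !mul0r !addr0.
rewrite (bigD1 j) //= eqxx mulr1 big1 ?addr0 // => i.
by rewrite eq_sym => /negPf->; rewrite mulr0.
Qed.

(** * Short functionals are coordinates up to sign *)

Lemma variance_gt0 N (s : nat -> int) (i0 i1 : 'I_N) : s i0 <> s i1 ->
  0 < N%:Z * (\sum_(i < N) s i ^+ 2) - (\sum_(i < N) s i) ^+ 2.
Proof.
move=> s01; set A := \sum_(i < N) s i; set B := \sum_(i < N) _; set n := N%:Z.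
have n0 : 0 < n by rewrite ltz_nat (leq_ltn_trans _ (ltn_ord i0)).
(* [A / n] is the mean; the scaled sum of squared deviations vanishes only for constant [s]. *)
have sumE : \sum_(i < N) (n * s i - A) ^+ 2 = n * (n * B - A ^+ 2).
  rewrite (eq_bigr (fun i : 'I_N =>
    n ^+ 2 * s i ^+ 2 - (2 * n * A) * s i - (- A ^+ 2) * 1)); last first.
    by move=> i _; ring.
  by rewrite sum_lin3 -/A -/B sumr_const card_ord natz -/n; ring.
rewrite -(pmulr_rgt0 _ n0) -sumE.
have sq i : 0 <= (n * s i - A) ^+ 2 by rewrite sqr_ge0.
rewrite lt_neqAle sumr_ge0 // andbT eq_sym; apply/negP => /eqP sum0.
have s0 := psumr_eq0P (fun (i : 'I_N) _ => sq i) sum0.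
have /eqP := s0 i0 isT; have /eqP := s0 i1 isT; rewrite !sqrf_eq0 !subr_eq0.
move=> /eqP e1 /eqP e0; apply: s01; apply: (mulfI (lt0r_neq0 n0)).
by rewrite e0 e1.
Qed.

(** On the lattice [f] is the pairing with integers [y i], and affine functions of [s] pair to zero.
    Once [y] is affine up to one entry, only that entry contributes. *)
Lemma short_functional d h (f : 'rV[int]_(d + 2) -> int) :
  (46 <= d)%N -> spaced (d + 2) (fun k => (Defs.sval d h k)%:Z) ->
  Defs.sval d h 1 = (Defs.sval d h 0).+1 ->
  (forall x y, inL d h x -> inL d h y -> f (x + y) = f x + f y) ->
  (forall x, inL d h x -> x <> 0 -> f x ^+ 2 < dotZ x x) ->
  exists (j : 'I_(d + 2)) (eps : int), `|eps| <= 1 /\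
    forall x, inL d h x -> f x = eps * x 0 j.
Proof.
move=> d46 sp s10 fD short.
have [N0 N1] : (0 < d + 2)%N /\ (1 < d + 2)%N by lia.
pose i0 : 'I_(d + 2) := Ordinal N0; pose i1 : 'I_(d + 2) := Ordinal N1.
pose s k := (Defs.sval d h k)%:Z.
have s1 : s i1 = s i0 + 1 by rewrite /s /= s10; lia.
pose r i := relvec s i0 i1 i.
have Lr i : inL d h (r i) by apply: inL_relvec.
have fE x : inL d h x -> f x = \sum_i x 0 i * f (r i).
  move=> Lx; rewrite [in LHS](relvec_span s1 Lx).
  rewrite (addL_sum fD) => [|i]; last exact: inLZ.
  by apply: eq_bigr => i _; rewrite (addLZ fD).
(* The value 0 outside the range only serves to index [y] by [nat]. *)
pose y k := if insub k is Some i then f (r i) else 0.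
have yE (i : 'I_(d + 2)) : y i = f (r i) by rewrite /y valK.
have {}fE x : inL d h x -> f x = \sum_(i < d + 2) x 0 i * y i.
  by move=> /fE->; apply: eq_bigr => i _; rewrite yE.
have [a [b [D ft]]] : exists a b D, fits (d + 2) s y D a b.
  pose n := (d + 2)%:Z; pose A := \sum_(i < d + 2) s i.
  pose B := \sum_(i < d + 2) s i ^+ 2; pose Y := \sum_(i < d + 2) y i.
  pose C := \sum_(i < d + 2) s i * y i.
  pose D := n * B - A ^+ 2; pose a := B * Y - A * C; pose b := n * C - A * Y.
  have D0 : 0 < D by apply: (@variance_gt0 _ s i0 i1); rewrite s1; lia.
  exists a, b, D; split=> //.
  (* By Cramer's rule [x] is [D] times the least squares residual of [y]. It is orthogonal to the
     constants and to [s], so it lies in the lattice and its norm is [D * f x]. *)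
  pose x : 'rV[int]_(d + 2) := \row_i (D * y i - a * 1 - b * s i).
  have Lx : inL d h x.
    apply/inLP; split.
      under eq_bigr do rewrite mxE.
      rewrite sum_lin3 sumr_const card_ord natz -/Y -/A -/n /D /a /b; ring.
    rewrite (eq_bigr (fun i : 'I_(d + 2) => D * (s i * y i) - a * s i - b * s i ^+ 2)).
      by rewrite sum_lin3 -/A -/B -/C /D /a /b; ring.
    by move=> i _; rewrite mxE /s; ring.
  have xx : dotZ x x = D * f x.
    have /inLP[x0 sx0] := Lx.
    rewrite fE // /dotZ (eq_bigr (fun i : 'I_(d + 2) =>
      D * (x 0 i * y i) - a * x 0 i - b * (s i * x 0 i))); last first.
      by move=> i _; rewrite {2}/x mxE; ring.
    by rewrite sum_lin3 x0 sx0 !mulr0 !subr0.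
  have -> : \sum_(0 <= k < d + 2) energy D a b s y k = dotZ x x.
    by rewrite big_mkord; apply: eq_bigr => i _; rewrite mxE mulr1 /energy expr2.
  have [x0|/eqP x0] := eqVneq x 0.
    by rewrite xx x0 (addL0 fD) mulr0 exprn_gt0.
  (* From [f x ^+ 2 < D * f x] follows [f x < D], hence the norm is less than [D ^+ 2]. *)
  have := short x Lx x0; rewrite xx !expr2 ltr_pM2l //.
  have := dotZ_ge0 x; rewrite xx pmulr_rge0 //.
  by move: (f x) => v; nia.
have N48 : (48 <= d + 2)%N by lia.
have [c [e [j yj]]] := near_affine N48 sp ft.
have fz x : inL d h x -> f x = \sum_(i < d + 2) (y i - c - e * s i) * x 0 i.
  move=> Lx; have /inLP[x0 sx0] := Lx.
  rewrite fE // [RHS](eq_bigr (fun i : 'I_(d + 2) =>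
    1 * (x 0 i * y i) - c * x 0 i - e * (s i * x 0 i))); last by move=> i _; ring.
  by rewrite sum_lin3 x0 sx0 !mulr0 !subr0 mul1r.
have [jN|Nj] := ltnP j (d + 2).
- exists (Ordinal jN), (y j - c - e * s j); split=> [|x Lx].
    by have := yj j jN; rewrite eqxx.
  rewrite fz // (bigD1 (Ordinal jN)) //= big1 ?addr0 // => i ij.
  have := yj i (ltn_ord i).
  rewrite (_ : (nat_of_ord i == j) = false); last by apply/negbTE.
  by rewrite normr_le0 => /eqP->; rewrite mul0r.
(* No exception in the range: [y] is affine and [f] vanishes on the lattice. *)
- exists i0, 0; split=> // x Lx; rewrite fz // mul0r big1 // => i _.
  have := yj i (ltn_ord i).
  rewrite (_ : (nat_of_ord i == j) = false); last by have := ltn_ord i; lia.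
  by rewrite normr_le0 => /eqP->; rewrite mul0r.
Qed.

(** * The non-holes of an admissible sequence *)

Section Nonholes.
Variables (d : nat) (h : seq nat).
Hypothesis adm : admissible_holes d h.

Let s := Defs.sval d h.

Lemma holes_uniq : uniq h.
Proof. by case: adm => _ /sorted_uniq-> //; [exact: ltn_trans | exact: ltnn]. Qed.

Lemma holes_range x : x \in h -> (7 <= x <= d + size h + 1)%N.
Proof.
case: adm => h0 srt hd lst _ /(nthP 0%N)[i ih <-].
have mono := sorted_leq_nth leq_trans leqnn 0%N (sub_sorted (@ltnW) srt).
have hN : ((size h).-1 < size h)%N by rewrite prednK.
rewrite -lst -nth_last; apply/andP; split; last by apply: mono; rewrite // -ltnS prednK.
by apply: leq_trans hd _; rewrite -nth0; apply: mono.
Qed.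

Lemma last_hole : (d + size h + 1)%N \in h.
Proof.
case: adm => h0 _ _ <- _.
by rewrite -nth_last mem_nth // prednK.
Qed.

Lemma holes_apart x y : x \in h -> y \in h -> (x < y)%N -> (x + 4 <= y)%N.
Proof.
case: adm => _ srt _ _ gap /(nthP 0%N)[i ih <-] /(nthP 0%N)[j jh <-] lt.
have mono := sorted_leq_nth leq_trans leqnn 0%N (sub_sorted (@ltnW) srt).
have [ji|ij] := leqP j i.
  by have := mono j i jh ih ji; rewrite leqNgt lt.
have ih' : (i.+1 < size h)%N by apply: leq_ltn_trans ij jh.
exact: leq_trans (gap i ih') (mono i.+1 j ih' jh ij).
Qed.

(** All holes lie in the range, so the filter removes exactly [size h] elements and [take] cuts
    nothing off. *)
Lemma size_nonholes_range :
  size [seq x <- iota 1 (d + 2 + size h) | x \notin h] = (d + 2)%N.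
Proof.
have := count_predC (mem h) (iota 1 (d + 2 + size h)).
rewrite size_iota -!size_filter /=.
have -> : size [seq x <- iota 1 (d + 2 + size h) | x \in h] = size h.
  apply/perm_size/uniq_perm; rewrite ?filter_uniq ?iota_uniq ?holes_uniq // => x.
  rewrite mem_filter mem_iota; case xh: (x \in h) => //=.
  by have := holes_range xh; lia.
by rewrite addnC => /addIn.
Qed.

Lemma nonholesE : nonholes d h = [seq x <- iota 1 (d + 2 + size h) | x \notin h].
Proof. by rewrite /nonholes take_oversize // size_nonholes_range. Qed.

Lemma size_nonholes : size (nonholes d h) = (d + 2)%N.
Proof. by rewrite nonholesE size_nonholes_range. Qed.

Lemma mem_nonholes x :
  (x \in nonholes d h) = (0 < x <= d + 2 + size h)%N && (x \notin h).
Proof. by rewrite nonholesE mem_filter mem_iota andbC; congr andb; lia. Qed.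

Lemma sorted_nonholes : sorted ltn (nonholes d h).
Proof. by rewrite nonholesE sorted_filter ?iota_ltn_sorted //; exact: ltn_trans. Qed.

Lemma sval_lt i j : (i < j < d + 2)%N -> (s i < s j)%N.
Proof.
move=> /andP[ij jN]; apply: (sorted_ltn_nth ltn_trans) => //;
  by rewrite ?sorted_nonholes ?inE ?size_nonholes //; lia.
Qed.

Lemma sval_mem i : (i < d + 2)%N -> (0 < s i <= d + 2 + size h)%N /\ s i \notin h.
Proof. by move=> iN; apply/andP; rewrite -mem_nonholes mem_nth ?size_nonholes. Qed.

Lemma sval_onto x : (0 < x <= d + 2 + size h)%N -> x \notin h ->
  exists2 i, (i < d + 2)%N & s i = x.
Proof.
move=> xr xh; have : x \in nonholes d h by rewrite mem_nonholes xr.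
by case/(nthP 0%N) => i; rewrite size_nonholes => iN <-; exists i.
Qed.

Lemma hole_between i m : (i.+1 < d + 2)%N -> (s i < m < s i.+1)%N -> m \in h.
Proof.
move=> iN im; apply: contraT => mh.
have [mr _] := sval_mem iN.
have [|j jN jm] := sval_onto _ mh; first by lia.
have [ji|ij] := leqP j i.
  have [ji'|ji'] : (j < i)%N \/ j = i by lia.
    by have := @sval_lt j i; lia.
  by rewrite ji' in jm; lia.
have [ij'|ij'] : (i.+1 < j)%N \/ i.+1 = j by lia.
  by have := @sval_lt i.+1 j; lia.
by rewrite -ij' in jm; lia.
Qed.

(** A gap of 3 or more would contain two consecutive holes, and two gaps 2 too close together would
    give holes less than 4 apart. *)
Lemma sval_spaced : spaced (d + 2) (fun k => (s k)%:Z).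
Proof.
have lt i : (i.+1 < d + 2)%N -> (s i < s i.+1)%N by move=> iN; apply: sval_lt; lia.
have hole i : (i.+1 < d + 2)%N -> (s i + 2 <= s i.+1)%N -> (s i + 1)%N \in h.
  by move=> iN si; apply: (hole_between iN); lia.
have gap i : (i.+1 < d + 2)%N -> (s i.+1 <= s i + 2)%N.
  move=> iN; rewrite leqNgt; apply/negP => si.
  have h1 : (s i + 1)%N \in h by apply: hole; lia.
  have h2 : (s i + 2)%N \in h by apply: (hole_between iN); lia.
  by have := holes_apart h1 h2; lia.
have apart i j : (i.+1 < d + 2)%N -> (j.+1 < d + 2)%N -> (s i < s j)%N ->
    (s j < s i + 4)%N -> (s i + 2 <= s i.+1)%N -> (s j.+1 <= s j + 1)%N.
  move=> iN jN ij ji si; rewrite leqNgt; apply/negP => sj.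
  have h1 := hole i iN si; have h2 : (s j + 1)%N \in h by apply: hole; lia.
  by have := holes_apart h1 h2; lia.
have gap2 i : (i.+2 < d + 2)%N -> (s i.+2 <= s i + 3)%N.
  move=> iN; have iN' : (i.+1 < d + 2)%N by lia.
  by have := lt i iN'; have := gap i iN'; have := gap _ iN; have := apart _ _ iN' iN; lia.
split=> i iN; first by have := lt i iN; have := gap i iN; lia.
  by have := gap2 i iN; lia.
have iN1 : (i.+1 < d + 2)%N by lia.
have iN2 : (i.+2 < d + 2)%N by lia.
have := gap2 _ iN2; have := gap2 _ iN; have := gap i iN1; have := gap _ iN2.
have := gap _ iN; have := lt i iN1; have := lt _ iN2; have := lt _ iN.
by have := apart _ _ iN1 iN; lia.
Qed.

Lemma sval_small i : (i < 6)%N -> (i < d + 2)%N -> s i = i.+1.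
Proof.
have small x : (0 < x < 7)%N -> x \notin h.
  by move=> x7; apply/negP => /holes_range; lia.
elim: i => [|i IH] i6 iN.
  have [s0 _] := sval_mem iN.
  have [||j jN s1] := @sval_onto 1%N _ _; [by lia | exact: small |].
  by case: j jN s1 => [//|j] jN s1; have := @sval_lt 0 j.+1; lia.
have {}IH := IH (ltnW i6) (ltnW iN).
have [||j jN sj] := @sval_onto i.+2 _ _; [by lia | by apply: small; lia |].
have lt : (s i < s i.+1)%N by apply: sval_lt; lia.
have [ji|ij] := leqP j i.
  have [ji'|ji'] : (j < i)%N \/ j = i by lia.
    by have := @sval_lt j i; lia.
  by rewrite ji' in sj; lia.
have [ij'|ij'] : (i.+1 < j)%N \/ i.+1 = j by lia.
  by have := @sval_lt i.+1 j; lia.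
by rewrite -sj -ij'.
Qed.

Lemma sval_last : s d.+1 = (d + 2 + size h)%N.
Proof.
have lastN : (d.+1 < d + 2)%N by lia.
have [lr _] := sval_mem lastN.
have nh : (d + 2 + size h)%N \notin h by apply/negP => /holes_range; lia.
have [|j jN sj] := sval_onto _ nh; first by lia.
have [jd|jd] : (j < d.+1)%N \/ j = d.+1 by lia.
  by have := @sval_lt j d.+1; lia.
by rewrite -jd.
Qed.

End Nonholes.

(** The last non-hole gives the number of holes, hence the range in which the holes are the
    complement. *)
Lemma holes_determined d h h' : admissible_holes d h -> admissible_holes d h' ->
  nonholes d h =i nonholes d h' -> h = h'.
Proof.
move=> adm adm' same.
have eqS : nonholes d h = nonholes d h'.
  apply: (irr_sorted_eq ltn_trans ltnn) => //; exact: sorted_nonholes.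
have szE : size h = size h'.
  have := sval_last adm; rewrite /Defs.sval eqS.
  by have := sval_last adm'; rewrite /Defs.sval; lia.
have mem k : k \in h = [&& (0 < k)%N, (k <= d + 2 + size h)%N & k \notin nonholes d h].
  rewrite mem_nonholes //; case kh: (k \in h); last by rewrite andbT; lia.
  by have := holes_range adm kh; rewrite andbF; lia.
have mem' k : k \in h' = [&& (0 < k)%N, (k <= d + 2 + size h)%N & k \notin nonholes d h].
  rewrite same szE mem_nonholes //; case kh: (k \in h'); last by rewrite andbT; lia.
  by have := holes_range adm' kh; rewrite andbF; lia.
case: (adm) (adm') => _ srt _ _ _ [_ srt' _ _ _].
by apply: (irr_sorted_eq ltn_trans ltnn) => // k; rewrite mem mem'.
Qed.

(** * Isometries as signed permutations of the coordinates *)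

Lemma coord_sq_lt d h (x : 'rV[int]_(d + 2)) i :
  inL d h x -> x <> 0 -> (x 0 i) ^+ 2 < dotZ x x.
Proof.
move=> /inLP[sum0 _] x0; rewrite (dotZ_coord x i) ltrDl.
have sq j : j != i -> 0 <= x 0 j ^+ 2 by rewrite sqr_ge0.
(* In case of equality [x] is supported at [i], where the zero sum makes it vanish too. *)
rewrite lt_neqAle sumr_ge0 ?andbT //; apply/eqP => /esym rest0; apply: x0.
have off j : j != i -> x 0 j = 0.
  by move=> ji; have /eqP := psumr_eq0P sq rest0 ji; rewrite sqrf_eq0 => /eqP.
apply/rowP => j; rewrite mxE; have [->|/off//] := eqVneq j i.
by move: sum0; rewrite (bigD1 i) //= big1 ?addr0.
Qed.

Lemma separating_vector d h (i j : 'I_(d + 2)) :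
  (46 <= d)%N -> admissible_holes d h -> i != j ->
  exists x, [/\ inL d h x, x 0 i = 1 & x 0 j = 0].
Proof.
move=> d46 adm ij.
(* Positions 0 to 5 form three disjoint pairs with unit gaps; [i] and [j] meet at most two of
   them. *)
have [k [k0 k1] [ki kj]] : exists2 k,
    (k.+1 < 6)%N /\ Defs.sval d h k.+1 = (Defs.sval d h k).+1
    & [&& k != i :> nat & k.+1 != i] /\ [&& k != j :> nat & k.+1 != j].
  have sm k : (k.+1 < 6)%N -> Defs.sval d h k.+1 = (Defs.sval d h k).+1.
    by move=> k6; rewrite !(sval_small adm) //; lia.
  have [|n0] := boolP [&& 0 != i, 1 != i, 0 != j & 1 != j]%N.
    by move=> n0; exists 0%N; [split => //; apply: sm | lia].
  have [|n2] := boolP [&& 2 != i, 3 != i, 2 != j & 3 != j]%N.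
    by move=> n2; exists 2%N; [split => //; apply: sm | lia].
  by exists 4%N; [split => //; apply: sm | lia].
have kN : (k < d + 2)%N by lia.
have kN1 : (k.+1 < d + 2)%N by lia.
pose o0 : 'I_(d + 2) := Ordinal kN; pose o1 : 'I_(d + 2) := Ordinal kN1.
exists (relvec (fun k => (Defs.sval d h k)%:Z) o0 o1 i).
split; first by apply: inL_relvec; rewrite /= k1; lia.
  rewrite mxE eqxx -!val_eqE /=; case/andP: ki.
  by rewrite eq_sym => /negPf->; rewrite eq_sym => /negPf->; rewrite !mulr0 !addr0.
rewrite mxE eq_sym (negPf ij) -!val_eqE /=; case/andP: kj.
by rewrite eq_sym => /negPf->; rewrite eq_sym => /negPf->; rewrite !mulr0 !addr0.
Qed.

(* The coordinate functionals, up to sign, are the only nonzero [f] with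
   [f x ^ 2 < (x, x)], so an isometry permutes them up to sign. *)
Lemma isometry_monomial d h h' :
  (46 <= d)%N -> admissible_holes d h -> admissible_holes d h' ->
  Lisometric d h h' ->
  exists (sigma : 'I_(d + 2) -> 'I_(d + 2)) (eps : 'I_(d + 2) -> int),
    [/\ injective sigma, forall i, `|eps i| = 1 &
        forall x, inL d h x -> inL d h' (\row_i (eps i * x 0 (sigma i)))].
Proof.
move=> d46 adm adm' [f [fL fD finj fsurj fdot]].
have coord i : exists j : 'I_(d + 2), exists eps : int,
    `|eps| <= 1 /\ forall x, inL d h x -> f x 0 i = eps * x 0 j.
  apply: (@short_functional d h (fun x => f x 0 i)) => //.
  - exact: sval_spaced.
  - by rewrite !(sval_small adm) //; lia.
  - by move=> x y Lx Ly; rewrite fD // mxE.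
  - move=> x Lx x0; rewrite -(fdot x x) //; apply: coord_sq_lt; first exact: fL.
    move=> fx0; apply: x0; apply: dotZ_eq0; rewrite -fdot // fx0 /dotZ big1 // => j _.
    by rewrite mxE mul0r.
have [sigma sigmaP] := fin_all_exists coord.
have [eps epsP] := fin_all_exists sigmaP.
(* By surjectivity coordinate [i] of the image takes the value 1. *)
have eps_neq0 i : eps i != 0.
  have [j ij] : exists j, i != j.
    have N0 : (0 < d + 2)%N by lia.
    have N1 : (1 < d + 2)%N by lia.
    have [->|i0] := eqVneq i (Ordinal N0); last by exists (Ordinal N0).
    by exists (Ordinal N1).
  have [z [Lz zi _]] := separating_vector d46 adm' ij.
  have [x Lx fx] := fsurj z Lz; have [_ fxi] := epsP i.
  by apply/eqP => e0; have := fxi x Lx; rewrite fx zi e0 mul0r.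
exists sigma, eps; split.
(* Otherwise coordinates [i] and [j] would be proportional on the image, against a vector with
   entries 1 and 0 there. *)
- move=> i j sij; apply/eqP; apply: contraT => ij.
  have [z [Lz zi zj]] := separating_vector d46 adm' ij.
  have [x Lx fx] := fsurj z Lz.
  have := (epsP j).2 x Lx; rewrite fx zj -sij => /esym/eqP.
  rewrite mulf_eq0 (negPf (eps_neq0 j)) /= => /eqP xs.
  by have := (epsP i).2 x Lx; rewrite fx zi xs mulr0.
- by move=> i; have [le _] := epsP i; have := eps_neq0 i; lia.
- move=> x Lx; rewrite (_ : \row_i _ = f x); first exact: fL.
  by apply/rowP => i; rewrite mxE (epsP i).2.
Qed.

(** * Recovering the holes from the lattice *)

Theorem theorem3p2 (d : nat) (h h' : seq nat) :
  (46 <= d)%N ->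
  admissible_holes d h -> admissible_holes d h' ->
  (Lisometric d h h' <-> h = h').
Proof.
move=> d46 adm adm'; split=> [iso|<-]; last first.
  by exists id; split=> // y Ly; exists y.
have [sigma [eps [sinj eps1 smap]]] := isometry_monomial d46 adm adm' iso.
have [tau sK tK] := injF_bij sinj.
pose s (k : nat) := (Defs.sval d h k)%:Z; pose s' (k : nat) := (Defs.sval d h' k)%:Z.
(* Evaluation on [relvec] shows that the coefficients of a linear relation are affine in [s]; the
   two equations of the target lattice, pulled back, are such relations. *)
have lin_rel (c : 'I_(d + 2) -> int) (i0 i1 i : 'I_(d + 2)) :
    (forall x, inL d h x -> \sum_k c k * x 0 k = 0) ->
    s i1 = s i0 + 1 -> c i = c i0 + (s i - s i0) * (c i1 - c i0).
  move=> c0 s1; have := c0 _ (inL_relvec i s1).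
  rewrite sum_relvec -/(s i) -/(s i0) => c_rel; apply/eqP; rewrite -subr_eq0 -c_rel.
  by apply/eqP; ring.
have reidx (F : 'I_(d + 2) -> int) (x : 'rV[int]_(d + 2)) :
    \sum_i F i * x 0 (sigma i) = \sum_k F (tau k) * x 0 k :> int.
  by rewrite [RHS](reindex_inj sinj); apply: eq_bigr => i _; rewrite sK.
have rel0 x : inL d h x -> \sum_k eps (tau k) * x 0 k = 0.
  move=> /smap/inLP[sum0 _]; rewrite -reidx -[RHS]sum0.
  by apply: eq_bigr => i _; rewrite mxE.
have rel1 x : inL d h x -> \sum_k (s' (tau k) * eps (tau k)) * x 0 k = 0.
  move=> /smap/inLP[_ sum1]; pose F (i : 'I_(d + 2)) := s' i * eps i.
  rewrite -[LHS]/(\sum_k F (tau k) * x 0 k) -reidx -[RHS]sum1.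
  by apply: eq_bigr => i _; rewrite mxE mulrA.
have ord k : (k < 6)%N -> exists i : 'I_(d + 2), i = k :> nat.
  by move=> k6; have kN : (k < d + 2)%N by [lia]; exists (Ordinal kN).
have [i0 i0E] := ord 0%N isT; have [i1 i1E] := ord 1%N isT.
have [i2 i2E] := ord 2%N isT.
have s_small (i : 'I_(d + 2)) k : (k < 6)%N -> i = k :> nat -> s i = k.+1.
  by move=> k6 ik; rewrite /s (sval_small adm) ?ik //; lia.
have s'_small (i : 'I_(d + 2)) k : (k < 6)%N -> i = k :> nat -> s' i = k.+1.
  by move=> k6 ik; rewrite /s' (sval_small adm') ?ik //; lia.
have s0 := s_small i0 0%N isT i0E; have s1 := s_small i1 1%N isT i1E.
have s2 := s_small i2 2%N isT i2E.
have s10 : s i1 = s i0 + 1 by rewrite s0 s1.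
have eps_const k : eps (tau k) = eps (tau i0).
  (* Since [s] is 1, 2, 3 at [i0], [i1], [i2], three signs are in arithmetic progression, hence
     equal. *)
  have e1 : eps (tau i1) = eps (tau i0).
    have := lin_rel _ i0 i1 i2 rel0 s10; rewrite s0 s2.
    by have := eps1 (tau i0); have := eps1 (tau i1); have := eps1 (tau i2); lia.
  by rewrite (lin_rel _ i0 i1 k rel0 s10) e1 subrr mulr0 addr0.
pose b := s' (tau i1) - s' (tau i0); pose a := s' (tau i0) - b.
have affine k : s' (tau k) = a + b * s k.
  have := lin_rel _ i0 i1 k rel1 s10; rewrite !eps_const s0 /a /b => e.
  have e0 : eps (tau i0) != 0 by have := eps1 (tau i0); lia.
  by apply: (mulIf e0); rewrite e; ring.
have at_pos (j : 'I_(d + 2)) : s' j = a + b * s (sigma j) by rewrite -affine sK.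
have pos1 := at_pos i0; rewrite (s'_small i0 0%N isT i0E) in pos1.
have pos2 := at_pos i1; rewrite (s'_small i1 1%N isT i1E) in pos2.
have sge1 (k : 'I_(d + 2)) : 1 <= s k.
  by have [] := sval_mem adm (ltn_ord k); rewrite /s; lia.
have s'ge1 (k : 'I_(d + 2)) : 1 <= s' k.
  by have [] := sval_mem adm' (ltn_ord k); rewrite /s'; lia.
(* [s'] takes the values 1 and 2, so [b] divides 1. *)
have bv : b * (s (sigma i1) - s (sigma i0)) = 1 by lia.
have [b1|b1] : b = 1 \/ b = -1.
  move/(congr1 absz)/eqP: bv; rewrite abszM muln_eq1 => /andP[/eqP b1 _].
  by lia.
(* Both sets of non-holes have minimum 1, so the translation is trivial. *)
- have a0 : a = 0.
    have := sge1 (sigma i0); have := s'ge1 (tau i0); have := affine i0.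
    by rewrite b1 s0 in pos1 *; lia.
  apply: (holes_determined adm adm') => x; apply/idP/idP.
    case/(nthP 0%N) => k; rewrite size_nonholes // => kN <-; rewrite -/(Defs.sval d h k).
    have := affine (Ordinal kN); rewrite a0 b1 add0r mul1r /s /s' /= => -[<-].
    by rewrite mem_nth // size_nonholes.
  case/(nthP 0%N) => k; rewrite size_nonholes // => kN <-; rewrite -/(Defs.sval d h' k).
  have := at_pos (Ordinal kN); rewrite a0 b1 add0r mul1r /s /s' /= => -[->].
  by rewrite mem_nth // size_nonholes.
- (* Here [S'] is the mirror image of [S]: it contains 2, so [S] contains the
     position just before its maximum, which is the last hole. *)
  exfalso; have dN : (d.+1 < d + 2)%N by lia.
  have sl := sval_last adm.
  have al := affine (Ordinal dN); rewrite /s /= sl in al.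
  have [sm _] := sval_mem adm (ltn_ord (sigma i0)).
  have [_ nh] := sval_mem adm (ltn_ord (sigma i1)).
  have := s'ge1 (tau (Ordinal dN)).
  case/negP: nh; rewrite (_ : Defs.sval d h _ = (d + size h + 1)%N).
    exact: last_hole.
  by move: pos1 pos2 al sm; rewrite b1 /s; have := s'ge1 (tau (Ordinal dN)); lia.
Qed.
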